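(* Let $M_n(x) := \sum_{k=0}^n \binom{n}{k}^2 (x-1)^k$. Then for every integer $n \geq 0$ and every prime $p\geq 3$, $$\nu_p(M_n(p)) = \nu_p(P_n(p)).$$
   Context: $P_n(x)$ denotes the $n$-th Legendre polynomial, $P_n(x) = \sum_{k=0}^{n} \binom{n}{k}\binom{n+k}{k}\left(\frac{x-1}{2}\right)^k$. For a nonzero rational $r$, $\nu_p(r)$ is its $p$-adic valuation (exponent of $p$ in $r$). *)

(* Defs.v *)
From mathcomp Require Import all_boot all_order all_algebra.
Set Implicit Arguments.
Unset Strict Implicit.
Unset Printing Implicit Defensive.
Import Order.TTheory GRing.Theory Num.Theory.
Local Open Scope ring_scope.

Definition legendre (n : nat) : {poly rat} :=
  \sum_(0 <= k < n.+1)
     ('C(n, k) * 'C(n + k, k))%:R *: (2^-1 *: ('X - 1)) ^+ k.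

Definition Mpoly (n : nat) : {poly rat} :=
  \sum_(0 <= k < n.+1) ('C(n, k) ^ 2)%:R *: ('X - 1) ^+ k.

(* Only meaningful for p prime and r != 0; padic_val p 0 = 0 is a junk value.
   The two positivity lemmas below show that it is never reached here. *)
Definition padic_val (p : nat) (r : rat) : int :=
  (logn p `|numq r|%N)%:Z - (logn p `|denq r|%N)%:Z.

Lemma legendre_gt0 (n : nat) (x : rat) : 1 <= x -> 0 < (legendre n).[x].
Proof.
move=> x1; rewrite /legendre horner_sum big_nat_recl //=.
rewrite ltr_pwDl //; last rewrite big_nat sumr_ge0 // => k _.
  by rewrite expr0 hornerZ hornerC bin0 bin0 mulr1.
rewrite hornerZ horner_exp !hornerE mulr_ge0 ?exprn_ge0 ?ler0n //.
by rewrite mulr_ge0 ?subr_ge0.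
Qed.

Lemma Mpoly_gt0 (n : nat) (x : rat) : 1 <= x -> 0 < (Mpoly n).[x].
Proof.
move=> x1; rewrite /Mpoly horner_sum big_nat_recl //=.
rewrite ltr_pwDl //; last rewrite big_nat sumr_ge0 // => k _.
  by rewrite expr0 hornerZ hornerC bin0 mulr1.
rewrite hornerZ horner_exp !hornerE mulr_ge0 ?exprn_ge0 ?ler0n //.
by rewrite subr_ge0.
Qed.

(* Main.v *)
Require Import Defs.
From mathcomp Require Import all_boot all_order all_algebra.
From mathcomp Require Import zify ring.
Import Order.TTheory GRing.Theory Num.Theory.
Local Open Scope ring_scope.

(** Both values are diagonal coefficients of the same family: with
    L_n(c, e) = [t^n] ((t + c)^2 - e)^n one has 2^n P_n(x) = L_n(x, 1) and
    2^n M_n(x) = L_n(x, (x - 2)^2), by factoring the difference of squares.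
    Expanding in powers of c,
    L_n(c, e) = sum_k C(n, k) C(2n - 2k, n) c^(n - 2k) (- e)^k,
    and for c = p the term k = floor(n / 2) has strictly smallest p-adic
    valuation: passing to a smaller k loses at most
    nu_p((n - 2k)!) <= (n - 2k) / 2 in the coefficient, while the power of p
    gains 2 (floor(n / 2) - k). Hence nu_p(L_n(p, e)) is the same for every
    integer e prime to p. *)

(* If n < 2k then 2(n - k) < n and the second binomial vanishes, so the
   truncated exponent n - 2k in [central_coef] is harmless. *)
Definition central_num (n k : nat) : nat := 'C(n, k) * 'C((n - k).*2, n).

Definition central_coef (R : comNzRingType) (n : nat) (c e : R) : R :=
  \sum_(k < n.+1) c ^+ (n - k.*2) * (- e) ^+ k *+ central_num n k.

Lemma coef_exp_addXC (R : comNzRingType) (c : R) (n i : nat) :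
  (('X + c%:P) ^+ n)`_i = c ^+ (n - i) *+ 'C(n, i).
Proof.
rewrite addrC exprDn coef_sum.
have [ile | nlt] := leqP i n; last first.
  rewrite bin_small // mulr0n big1 // => k _.
  rewrite coefMn -polyC_exp coefCM coefXn gtn_eqF ?mulr0 ?mul0rn //.
  by have := ltn_ord k; lia.
rewrite (bigD1 (Ordinal (ile : i < n.+1)%N)) //= big1 ?addr0 => [|k neqk].
  by rewrite coefMn -polyC_exp coefCM coefXn eqxx mulr1.
rewrite coefMn -polyC_exp coefCM coefXn.
suff /negPf -> : i != k by rewrite mulr0 mul0rn.
by apply: contra neqk => /eqP ik; apply/eqP/val_inj.
Qed.

Lemma central_coefE (R : comNzRingType) (n : nat) (c e : R) :
  ((('X + c%:P) ^+ 2 - e%:P) ^+ n)`_n = central_coef R n c e.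
Proof.
rewrite exprDn coef_sum; apply: eq_bigr => k _.
rewrite coefMn -exprM -polyCN -polyC_exp coefMC coef_exp_addXC.
rewrite mulrnAl -mulrnA mul2n mulnC -/(central_num n k).
by congr (_ ^+ _ * _ *+ _); have := ltn_ord k; lia.
Qed.

(** With u = t + x - 1 the difference of squares is u (2 + u). Expanding (2 + u)^n leaves the
    coefficients of t^n in u^(n + k). The right side is 2^n P_n(x) with denominators cleared, so it
    makes sense over the integers. *)
Lemma central_coef_legendre (R : comNzRingType) (n : nat) (x : R) :
  central_coef R n x 1 =
  \sum_(k < n.+1) 2 ^+ (n - k) * (x - 1) ^+ k *+ ('C(n, k) * 'C(n + k, k)).
Proof.
rewrite -central_coefE.
have -> : ('X + x%:P) ^+ 2 - 1%:P =
    (('X + (x - 1)%:P) * (2%:P + ('X + (x - 1)%:P))) :> {poly R}.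
  by rewrite polyCB polyCMn; ring.
rewrite exprMn [(2%:P + _) ^+ n]exprDn mulr_sumr coef_sum.
apply: eq_bigr => k _.
rewrite mulrnAr coefMn mulrCA -exprD -polyC_exp coefCM coef_exp_addXC.
by rewrite addKn mulrnAr -mulrnA mulnC -(bin_sub (leq_addl n k)) addnK.
Qed.

(** Here the factors are t + 2 and t + 2 (x - 1); the Cauchy product of their n-th powers pairs C(n,
    k) with C(n, n - k), whence the squares. *)
Lemma central_coef_Mpoly (R : comNzRingType) (n : nat) (x : R) :
  central_coef R n x ((x - 2) ^+ 2) =
  2 ^+ n * \sum_(k < n.+1) (x - 1) ^+ k *+ ('C(n, k) ^ 2).
Proof.
rewrite -central_coefE.
have -> : ('X + x%:P) ^+ 2 - ((x - 2) ^+ 2)%:P =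
    ('X + 2%:P) * ('X + (2 * (x - 1))%:P) :> {poly R}.
  by rewrite polyC_exp polyCM !polyCB; ring.
rewrite exprMn coefM mulr_sumr; apply: eq_bigr => k _.
have kn : (k <= n)%N by have := ltn_ord k; lia.
rewrite !coef_exp_addXC subKn // bin_sub // exprMn.
by rewrite [RHS]mulrnAr mulrnAl mulrnAr -mulrnA mulrA -exprD subnK // mulnn.
Qed.

Lemma logn_fact_double_le (p n : nat) :
  prime p -> (3 <= p)%N -> ((logn p n`!).*2 <= n)%N.
Proof.
move=> p_pr p_ge3; rewrite logn_fact //.
(* Partial sums in Legendre's formula, strengthened by a tail so that induction closes: the next
   quotient b counts twice in the sum and once as the new tail, and 3 b is at most the old tail
   because p >= 3. *)
suff H K : ((\sum_(1 <= k < K.+1) n %/ p ^ k).*2 + n %/ p ^ K <= n)%N.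
  exact: leq_trans (leq_addr _ _) (H n).
elim: K => [|K IH]; first by rewrite big_nil divn1.
rewrite big_nat_recr //= expnSr divnMA.
have : (n %/ p ^ K %/ p * 3 <= n %/ p ^ K)%N.
  by apply: leq_trans (leq_divM _ p); rewrite leq_mul.
move: (\sum_(_ <= _ < _) _)%N (n %/ p ^ K)%N (_ %/ p)%N IH => s a b; lia.
Qed.

(** The falling factorial is (2 m)! / m!, and passing from N to N + 1 multiplies it by 2 (2 N +
    1). *)
Lemma ffact_double_dvd (m n : nat) : (m <= n)%N -> (m.*2 ^_ m %| n.*2 ^_ n)%N.
Proof.
move=> /subnK <-; elim: (n - m)%N => // d IH; rewrite addSn.
apply: dvdn_trans IH _; set N := (d + m)%N.
suff -> : (N.+1.*2 ^_ N.+1 = (N.*2.+1).*2 * N.*2 ^_ N)%N by rewrite dvdn_mull.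
apply/eqP; rewrite -(eqn_pmul2r (fact_gt0 N.+1)); apply/eqP.
have F k : (k.*2 ^_ k * k`! = k.*2`!)%N.
  by rewrite -[X in X`!](_ : k.*2 - k = k)%N ?ffact_fact //; lia.
by rewrite F doubleS !factS -F; nia.
Qed.

(** The right side depends on n - k alone, so coefficients at two indices can be compared through
    [ffact_double_dvd]. *)
Lemma central_num_fact (n k : nat) : (k.*2 <= n)%N ->
  (central_num n k * (k`! * (n - k.*2)`!) = (n - k).*2 ^_ (n - k))%N.
Proof.
move=> kn; apply/eqP; rewrite -(eqn_pmul2r (fact_gt0 (n - k))); apply/eqP.
have -> : ((n - k).*2 ^_ (n - k) * (n - k)`! = (n - k).*2`!)%N.
  rewrite -[X in (_ * X`!)%N](_ : (n - k).*2 - (n - k) = n - k)%N; last lia.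
  by rewrite ffact_fact //; lia.
have E1 : ('C(n, k) * (k`! * (n - k)`!) = n`!)%N by rewrite bin_fact //; lia.
have E2 : ('C((n - k).*2, n) * (n`! * (n - k.*2)`!) = (n - k).*2`!)%N.
  rewrite -(@bin_fact (n - k).*2 n); last lia.
  by congr (_ * (_ * _`!))%N; lia.
rewrite -E2 -E1 /central_num; ring.
Qed.

Lemma central_num_gt0 (n k : nat) : (k.*2 <= n)%N -> (0 < central_num n k)%N.
Proof. by move=> kn; rewrite muln_gt0 !bin_gt0; lia. Qed.

(** Since k! divides m!, the divisibility of falling factorials leaves only nu_p((n - 2k)!) as
    possible loss. Doubling avoids halves. *)
Lemma logn_central_num (p n k m : nat) : prime p -> (3 <= p)%N ->
  (k <= m)%N -> (m.*2 <= n)%N ->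
  ((logn p (central_num n m)).*2 <= (logn p (central_num n k)).*2 + (n - k.*2))%N.
Proof.
move=> p_pr p_ge3 km mn.
have kn : (k.*2 <= n)%N by lia.
have gm := @central_num_gt0 n m mn; have gk := @central_num_gt0 n k kn.
have D : ((n - m).*2 ^_ (n - m) %| (n - k).*2 ^_ (n - k))%N.
  by apply: ffact_double_dvd; lia.
have kfact : (k`! %| m`!)%N by rewrite -(bin_fact km) dvdn_mull // dvdn_mulr.
have := dvdn_leq_log p (fact_gt0 m) kfact.
have := @logn_fact_double_le p (n - k.*2) p_pr p_ge3.
have pos : (0 < (n - k).*2 ^_ (n - k))%N by rewrite ffact_gt0; lia.
have := dvdn_leq_log p pos D; rewrite -!central_num_fact //.
move: (central_num n m) (central_num n k) gm gk => a b a_gt0 b_gt0.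
by rewrite !lognM ?muln_gt0 ?fact_gt0 //; lia.
Qed.

Lemma logn_central_coef (p n : nat) (e : int) : prime p -> (3 <= p)%N ->
  ~~ (p %| e)%Z ->
  logn p `|central_coef int n p%:Z e|%N =
  logn p (p ^ odd n * central_num n n./2).
Proof.
move=> p_pr p_ge3 pe.
have p_gt0 := prime_gt0 p_pr.
have n2 : (n = odd n + n./2.*2)%N by rewrite odd_double_half.
have n2le : (n./2.*2 <= n)%N by lia.
have lt_half : (n./2 < n.+1)%N by lia.
set T := (_ * _)%N; set v := logn p T.
have T_gt0 : (0 < T)%N by rewrite muln_gt0 expn_gt0 p_gt0 central_num_gt0.
have [t pt Tt] := pfactor_coprime p_pr T_gt0.
rewrite /central_coef (bigD1 (Ordinal lt_half)) //=.
set w := \sum_(k < _ | _) _.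
have : (p%:Z ^+ v.+1 %| w)%Z.
  apply: rpred_sum => k neqk.
  have {}neqk : (k : nat) != n./2.
    by apply: contra neqk => /eqP E; apply/eqP/val_inj.
  have [k_gt | k_le] := ltnP n k.*2.
    rewrite /central_num (@bin_small _ n) ?muln0 ?mulr0n ?dvdz0 //.
    by have := ltn_ord k; lia.
  have km : (k <= n./2)%N by lia.
  rewrite -mulrnAl dvdz_mulr // -mulr_natr natz dvdzE abszM !abszX !absz_nat.
  (* Put d = n./2 - k >= 1, so n - 2k = odd n + 2d. By integrality the coefficient loses at most d,
     while the power of p gains 2d. *)
  have := @logn_central_num p n k n./2 p_pr p_ge3 km n2le.
  have := @central_num_gt0 n k k_le; have := @central_num_gt0 n n./2 n2le.
  rewrite /v /T; move: (central_num n k) (central_num n n./2) => a b b_gt0 a_gt0.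
  rewrite pfactor_dvdn ?muln_gt0 ?a_gt0 ?expn_gt0 ?p_gt0 //.
  by rewrite !lognM ?expn_gt0 ?p_gt0 // !pfactorK //; lia.
case/dvdzP => q ->.
have -> : p%:Z ^+ (n - n./2.*2) * (- e) ^+ n./2 *+ central_num n n./2 =
    T%:Z * (- e) ^+ n./2.
  rewrite /T PoszM -[(p ^ _)%:Z]natz natrX natz -[(central_num _ _)%:Z]natz.
  rewrite -mulr_natr [in RHS]mulrAC; congr (_ ^+ _ * _ * _); lia.
rewrite {1}Tt PoszM -/v -[(p ^ v)%:Z]natz natrX natz exprS.
set u := (- e) ^+ _.
have -> : t%:Z * p%:Z ^+ v * u + q * (p%:Z * p%:Z ^+ v) =
    p%:Z ^+ v * (t%:Z * u + q * p%:Z).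
  by ring.
rewrite abszM abszX absz_nat.
set s := _ + _.
(* Modulo p only t u survives, and p divides neither t nor e. *)
have H : coprime p `|s|%N.
  rewrite prime_coprime // -[(p %| _)%N]/(p%:Z %| s)%Z.
  rewrite rpredDr; last by rewrite dvdz_mull.
  rewrite dvdzE abszM absz_nat Euclid_dvdM // negb_or.
  rewrite -prime_coprime // pt /u abszX abszN Euclid_dvdX //.
  by rewrite negb_and pe.
rewrite lognM ?expn_gt0 ?p_gt0 //; first by rewrite pfactorK // logn_coprime ?addn0.
by case: `|_|%N H => //; rewrite /coprime gcdn0 => /eqP; lia.
Qed.

(** Reduces a rational valuation to an integer one; it serves with d = 2^n, prime to p as p is
    odd. *)
Lemma padic_val_frac (p d : nat) (z : int) (r : rat) :
  prime p -> coprime p d -> r != 0 -> d%:R * r = z%:~R ->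
  padic_val p r = (logn p `|z|%N)%:Z.
Proof.
move=> p_pr pd r0 drz.
have d_gt0 : (0 < d)%N.
  by case: d pd {drz} => //; rewrite /coprime gcdn0 => /eqP p1; rewrite p1 in p_pr.
have E : d%:Z * numq r = z * denq r.
  apply: (@intr_inj rat); rewrite !rmorphM /= -drz numqE.
  by rewrite -mulrA.
have := congr1 (fun x : int => logn p `|x|%N) E.
have nz : (0 < `|numq r|)%N by rewrite absz_gt0 numq_eq0.
have dz : (0 < `|denq r|)%N by rewrite absz_gt0 denq_eq0.
have zz : (0 < `|z|)%N.
  by rewrite absz_gt0 -(intr_eq0 rat) -drz mulf_neq0 // pnatr_eq0 -lt0n.
rewrite !abszM !lognM // absz_nat (logn_coprime pd) /padic_val; lia.
Qed.

Lemma rmorph_central_coef (R S : comNzRingType) (f : {rmorphism R -> S})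
    (n : nat) (c e : R) :
  f (central_coef R n c e) = central_coef S n (f c) (f e).
Proof.
rewrite rmorph_sum; apply: eq_bigr => k _.
by rewrite rmorphMn rmorphM !rmorphXn rmorphN.
Qed.

Theorem theorem8 (n p : nat) (p_prime : prime p) (p_ge3 : (3 <= p)%N) :
  padic_val p (Mpoly n).[p%:R] = padic_val p (legendre n).[p%:R].
Proof.
have p_ge1 : 1 <= p%:R :> rat by rewrite ler1n prime_gt0.
have p2n : coprime p (2 ^ n).
  by rewrite coprimeXr // prime_coprime // gtnNdvd.
have p1 : ~~ (p %| 1)%Z by rewrite dvdzE gtnNdvd //; lia.
(* Modulo p the base is -2, and p >= 3 does not divide 2. *)
have pM : ~~ (p %| (p%:Z - 2) ^+ 2)%Z.
  rewrite dvdzE abszX Euclid_dvdX // negb_and /= orbF.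
  rewrite -[(p %| _)%N]/(p%:Z %| (p%:Z - 2)%R)%Z rpredBl ?dvdzz //.
  by rewrite dvdzE gtnNdvd.
rewrite (@padic_val_frac p (2 ^ n) (central_coef int n p%:Z ((p%:Z - 2) ^+ 2))) //;
  last 2 first.
- by rewrite gt_eqF // Mpoly_gt0.
- rewrite (@rmorph_central_coef int rat intr).
  rewrite rmorphXn rmorphB /= central_coef_Mpoly.
  rewrite /Mpoly horner_sum big_mkord natrX.
  congr (_ * _); apply: eq_bigr => k _.
  by rewrite !hornerE /= mulr_natl.
rewrite (@padic_val_frac p (2 ^ n) (central_coef int n p%:Z 1)) //; last 2 first.
- by rewrite gt_eqF // legendre_gt0.
- rewrite (@rmorph_central_coef int rat intr).
  rewrite rmorph1 central_coef_legendre.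
  rewrite /legendre horner_sum big_mkord natrX mulr_sumr.
  apply: eq_bigr => k _.
  have kn : (k <= n)%N by have := ltn_ord k; lia.
  have -> : 2 ^+ n = 2 ^+ (n - k) * 2 ^+ k :> rat by rewrite -exprD subnK.
  have two_k : 2 ^+ k != 0 :> rat by rewrite expf_neq0.
  rewrite !hornerE /= exprMn exprVn -mulr_natr.
  by field.
(* The common value does not involve e. *)
by rewrite !logn_central_coef.
Qed.
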